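(* Let $\mathbb{F}$ be a field of characteristic $2$ and $P\in\mathbb{F}[x_1,\dots,x_m]$. Then $P$ is representable if and only if $P$ admits a generalized symmetric determinantal representation.
   Context: $P$ is representable if there is a symmetric matrix $M$ with all entries in $\mathbb{F}\cup\{x_1,\dots,x_m\}$ with $\det(M)=P$. A generalized symmetric determinantal representation (gSDR) of $P$ is a symmetric matrix $M$ with entries in $\mathbb{F}[x_1,\dots,x_m]$ such that $\det(M)=P$ and each diagonal entry is either a constant of $\mathbb{F}$ or of the form $P_0^2+x_1P_1^2+\dots+x_mP_m^2$ for some $P_0,\dots,P_m\in\mathbb{F}[x_1,\dots,x_m]$. *)

(* Defs.v *)
From HB Require Import structures.
From mathcomp Require Import all_boot all_algebra.
From mathcomp Require Import mpoly.

Set Implicit Arguments.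
Unset Strict Implicit.
Unset Printing Implicit Defensive.

Import GRing.Theory.
Local Open Scope ring_scope.

Section SymmetricDeterminantalRepresentations.
Variables (F : fieldType) (m : nat).
Implicit Types (P p : {mpoly F[m]}).

Definition constant_poly p : Prop := exists c : F, p = c%:MP.

Definition constant_or_variable p : Prop :=
  constant_poly p \/ exists k : 'I_m, p = 'X_k.

Definition twisted_square_sum p : Prop :=
  exists (P0 : {mpoly F[m]}) (Q : 'I_m -> {mpoly F[m]}),
    p = P0 ^+ 2 + \sum_(k < m) 'X_k * Q k ^+ 2.

(* Matrices have size at least 1; the size-0 matrix, of determinant 1, would
   only add a representation of 1, already represented by the matrix (1). *)
Definition representable P : Prop :=
  exists (n : nat) (M : 'M[{mpoly F[m]}]_n.+1),
    [/\ M^T = M,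
        forall i j, constant_or_variable (M i j)
      & \det M = P].

Definition has_gSDR P : Prop :=
  exists (n : nat) (M : 'M[{mpoly F[m]}]_n.+1),
    [/\ M^T = M,
        \det M = P
      & forall i, constant_poly (M i i) \/ twisted_square_sum (M i i)].

End SymmetricDeterminantalRepresentations.

(* Main.v *)
Require Import Defs.
From HB Require Import structures.
From mathcomp Require Import all_boot all_algebra.
From mathcomp Require Import mpoly.

(** If det D = 1, then M - C D^-1 C^T has the determinant of the bordered matrix
    with rows (M C) and (C^T D). Every polynomial matrix U factors as r L^-1 c
    with r, c constant and L of determinant 1 with entries that are
    constants or variables; this is the linear realization of noncommutative
    rational functions, and is closed under sums and products. Placing L and
    L^T off-diagonally in D shows that x U U^T is of the form C D^-1 C^T for
    x equal to 1 or to a variable. A gSDR is the sum of a constant diagonal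
    matrix and of such terms: its diagonal squares are of this form, and if
    T is its strictly upper triangular part, then in characteristic 2
    T + T^T = (T + 1)(T + 1)^T + T T^T + 1 1^T. *)

Set Implicit Arguments.
Unset Strict Implicit.
Unset Printing Implicit Defensive.

Import GRing.Theory.
Local Open Scope ring_scope.

(** * Linear realizations of polynomial matrices *)

Section Realizations.
Variables (F : fieldType) (m : nat).
Local Notation R := {mpoly F[m]}.
Local Notation cmx := (map_mx (@mpolyC m F)).

Lemma constant_or_variable0 : constant_or_variable (0 : R).
Proof. by left; exists 0; rewrite mpolyC0. Qed.

Lemma constant_or_variable1 : constant_or_variable (1 : R).
Proof. by left; exists 1; rewrite mpolyC1. Qed.

Definition cv_mx a b (A : 'M[R]_(a, b)) : Prop :=
  forall i j, constant_or_variable (A i j).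

Lemma cv_mxT a b (A : 'M[R]_(a, b)) : cv_mx A -> cv_mx A^T.
Proof. by move=> hA i j; rewrite mxE; apply: hA. Qed.

Lemma cv_cmx a b (A : 'M[F]_(a, b)) : cv_mx (cmx A).
Proof. by move=> i j; rewrite mxE; left; exists (A i j). Qed.

Lemma cv_mx0 a b : cv_mx (0 : 'M[R]_(a, b)).
Proof. by move=> i j; rewrite mxE; apply: constant_or_variable0. Qed.

Lemma cv_scalar_mx a (x : R) : constant_or_variable x -> cv_mx (x%:M : 'M_a).
Proof.
move=> hx i j; rewrite mxE; case: eqP => _ //.
exact: constant_or_variable0.
Qed.

Lemma cv_mx1 a : cv_mx (1%:M : 'M[R]_a).
Proof. by apply: cv_scalar_mx; apply: constant_or_variable1. Qed.

Lemma cv_block_mx a1 a2 b1 b2 (A : 'M[R]_(a1, b1)) (B : 'M[R]_(a1, b2))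
    (C : 'M[R]_(a2, b1)) (D : 'M[R]_(a2, b2)) :
  cv_mx A -> cv_mx B -> cv_mx C -> cv_mx D -> cv_mx (block_mx A B C D).
Proof.
move=> hA hB hC hD i j; rewrite !mxE.
by case: split => i'; rewrite !mxE; case: split.
Qed.

(** The inverse [V] of [L] is a witness, so that each construction below can give it in closed
    form. *)
Definition realizable a b (U : 'M[R]_(a, b)) : Prop :=
  exists (N : nat) (L V : 'M[R]_N) (r : 'M[F]_(a, N)) (c : 'M[F]_(N, b)),
    [/\ cv_mx L, L *m V = 1%:M, \det L = 1 & U = cmx r *m V *m cmx c].

Lemma realizable_cmx a b (A : 'M[F]_(a, b)) : realizable (cmx A).
Proof.
exists a, 1%:M, 1%:M, 1%:M, A; split; rewrite ?mulmx1 ?det1 //.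
- exact: cv_mx1.
- by rewrite map_mx1 mul1mx.
Qed.

Lemma realizableD a b (U1 U2 : 'M[R]_(a, b)) :
  realizable U1 -> realizable U2 -> realizable (U1 + U2).
Proof.
case=> N1 [L1] [V1] [r1] [c1] [hL1 LV1 dL1 ->].
case=> N2 [L2] [V2] [r2] [c2] [hL2 LV2 dL2 ->].
exists (N1 + N2)%N, (block_mx L1 0 0 L2), (block_mx V1 0 0 V2),
  (row_mx r1 r2), (col_mx c1 c2); split.
- by apply: cv_block_mx => //; apply: cv_mx0.
- rewrite mulmx_block LV1 LV2 !(mulmx0, mul0mx, addr0, add0r).
  by rewrite -scalar_mx_block.
- by rewrite det_ublock dL1 dL2 mulr1.
- rewrite map_row_mx map_col_mx mul_row_block mul_row_col.
  by rewrite !(mulmx0, addr0, add0r).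
Qed.

(** The coupling block [K] is constant. The inverse of the triangular matrix has [V1 c1 r2 V2] in
    its upper right corner, which [r1] and [c2] extract. *)
Lemma realizableM a b d (U1 : 'M[R]_(a, b)) (U2 : 'M[R]_(b, d)) :
  realizable U1 -> realizable U2 -> realizable (U1 *m U2).
Proof.
case=> N1 [L1] [V1] [r1] [c1] [hL1 LV1 dL1 ->].
case=> N2 [L2] [V2] [r2] [c2] [hL2 LV2 dL2 ->].
pose K : 'M[R]_(N1, N2) := cmx (- (c1 *m r2)).
exists (N1 + N2)%N, (block_mx L1 K 0 L2),
  (block_mx V1 (- (V1 *m K *m V2)) 0 V2), (row_mx r1 0), (col_mx 0 c2); split.
- by apply: cv_block_mx => //; [apply: cv_cmx | apply: cv_mx0].
- rewrite mulmx_block LV2 LV1 !(mulmx0, mul0mx, addr0, add0r) mulmxN.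
  by rewrite !mulmxA LV1 mul1mx addNr -scalar_mx_block.
- by rewrite det_ublock dL1 dL2 mulr1.
- rewrite map_row_mx map_col_mx mul_row_block mul_row_col !map_mx0.
  rewrite !(mulmx0, mul0mx, addr0, add0r) /K map_mxN map_mxM.
  by rewrite !(mulmxN, mulNmx) opprK !mulmxA.
Qed.

Lemma realizable_var a (k : 'I_m) : realizable (('X_k : R)%:M : 'M_a).
Proof.
(* Inverting this unipotent matrix puts [- 'X_k] in the corner; the sign in [r] undoes the minus. *)
exists (a + a)%N, (block_mx 1%:M ('X_k)%:M 0 1%:M),
  (block_mx 1%:M (- ('X_k)%:M) 0 1%:M), (row_mx (- 1%:M) 0), (col_mx 0 1%:M).
split.
- apply: cv_block_mx; try exact: cv_mx1; last exact: cv_mx0.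
  by apply: cv_scalar_mx; right; exists k.
- rewrite mulmx_block !(mulmx0, mul0mx, mulmx1, mul1mx, addr0, add0r) addNr.
  by rewrite -scalar_mx_block.
- by rewrite det_ublock !det1 mulr1.
- rewrite map_row_mx map_col_mx mul_row_block mul_row_col.
  rewrite !map_mx0 map_mxN !map_mx1.
  rewrite !(mulmx0, mul0mx, mulmx1, mul1mx, addr0, add0r).
  by rewrite mulNmx mul1mx opprK.
Qed.

(** Sums and products of polynomials become those of scalar matrices, so constants and variables
    suffice. *)
Lemma realizable_scalar a (p : R) : realizable (p%:M : 'M_a).
Proof.
have const c : realizable ((c%:MP : R)%:M : 'M_a).
  by rewrite -map_scalar_mx; apply: realizable_cmx.
elim/mpolyind: p => [|c mn p _ _ IHp]; first by rewrite -mpolyC0.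
rewrite raddfD /=; apply: realizableD IHp.
rewrite -mul_mpolyC scalar_mxM; apply: realizableM => //; rewrite mpolyXE_id.
elim/big_rec: _ => [|i p' _ IHp']; first by rewrite -mpolyC1.
rewrite scalar_mxM; apply: realizableM => //.
elim: (mn i) => [|n IHn]; first by rewrite expr0 -mpolyC1.
by rewrite exprS scalar_mxM; apply: realizableM => //; apply: realizable_var.
Qed.

Lemma realizable_all a b (U : 'M[R]_(a, b)) : realizable U.
Proof.
have sum I (s : seq I) (f : I -> 'M[R]_(a, b)) :
    (forall i, realizable (f i)) -> realizable (\sum_(i <- s) f i).
  move=> hf; elim/big_rec: _ => [|i A _ hA]; last exact: realizableD.
  by rewrite -(map_mx0 (@mpolyC m F)); apply: realizable_cmx.
rewrite (matrix_sum_delta U); apply: (sum) => i; apply: (sum) => j.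
rewrite -mul_scalar_mx; apply: realizableM; first exact: realizable_scalar.
by rewrite -(map_delta_mx (@mpolyC m F)); apply: realizable_cmx.
Qed.

(** * Schur complements and bordered matrices *)

(* If [D] is the corner block of [block_mx M C C^T D], then the Schur complement
   of [D] is [M + A]. *)
Definition schur_term n (A : 'M[R]_n) : Prop :=
  exists (N : nat) (D E : 'M[R]_N) (C : 'M[R]_(n, N)),
    [/\ D^T = D, cv_mx D, cv_mx C, E *m D = 1%:M & \det D = 1]
    /\ A = - (C *m E *m C^T).

Lemma schur_term0 n : schur_term (0 : 'M[R]_n).
Proof.
exists 0%N, 1%:M, 1%:M, 0; split; last by rewrite !mul0mx oppr0.
by split; rewrite ?trmx1 ?mulmx1 ?det1 //; [apply: cv_mx1 | apply: cv_mx0].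
Qed.

Lemma schur_termD n (A B : 'M[R]_n) :
  schur_term A -> schur_term B -> schur_term (A + B).
Proof.
case=> N1 [D1] [E1] [C1] [[sD1 hD1 hC1 ED1 dD1] ->].
case=> N2 [D2] [E2] [C2] [[sD2 hD2 hC2 ED2 dD2] ->].
exists (N1 + N2)%N, (block_mx D1 0 0 D2), (block_mx E1 0 0 E2), (row_mx C1 C2).
split; first split.
- by rewrite tr_block_mx sD1 sD2 !trmx0.
- by apply: cv_block_mx => //; apply: cv_mx0.
- by move=> i j; rewrite mxE; case: split.
- rewrite mulmx_block ED1 ED2 !(mulmx0, mul0mx, addr0, add0r).
  by rewrite -scalar_mx_block.
- by rewrite det_ublock dD1 dD2 mulr1.
- rewrite tr_row_mx mul_row_block mul_row_col.
  by rewrite !(mulmx0, addr0, add0r) opprD.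
Qed.

Lemma schur_term_sum n I (s : seq I) (f : I -> 'M[R]_n) :
  (forall i, schur_term (f i)) -> schur_term (\sum_(i <- s) f i).
Proof.
move=> hf; elim/big_rec: _ => [|i A _ hA]; first exact: schur_term0.
exact: schur_termD.
Qed.

Lemma det_add_schur_term n (A B : 'M[R]_n.+1) :
  A^T = A -> cv_mx A -> schur_term B -> representable (\det (A + B)).
Proof.
move=> sA hA [N] [D] [E] [C] [[sD hD hC ED dD] ->].
pose S : 'M[R]_(n.+1 + N) := block_mx A C C^T D.
have sS : S^T = S by rewrite tr_block_mx sA sD trmxK.
have hS : cv_mx S by apply: cv_block_mx => //; apply: cv_mxT.
exists (n + N)%N, S; split=> //.
(* Column elimination clears the block [C^T] of [S]; since [\det D = 1], no extra factor remains. *)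
have : S *m block_mx 1%:M 0 (- (E *m C^T)) 1%:M
     = block_mx (A - C *m E *m C^T) C 0 D.
  rewrite mulmx_block !(mulmx0, mulmx1, add0r) !mulmxN mulmxA.
  by rewrite [D *m _]mulmxA (mulmx1C ED) mul1mx subrr.
move/(congr1 (@determinant _ _)).
by rewrite det_mulmx det_lblock det_ublock !det1 dD !mulr1.
Qed.

(** * Schur terms in characteristic 2 *)

Hypothesis char2 : 2%N \in [pchar R].

(** Swapping the two block columns gives a triangular matrix. The swap is an involution, so its
    determinant is 1 or -1, which agree in characteristic 2. *)
Lemma det_swap_block N (B K : 'M[R]_N) :
  \det (block_mx B K K^T 0) = \det K ^+ 2.
Proof.
pose J : 'M[R]_(N + N) := block_mx 0 1%:M 1%:M 0.
have dJ : \det J = 1.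
  have : \det J ^+ 2 = 1.
    rewrite expr2 -det_mulmx mulmx_block.
    by rewrite !(mulmx0, mulmx1, addr0, add0r) -scalar_mx_block det1.
  move/eqP; rewrite sqrf_eq1 => /orP[] /eqP // ->.
  exact: (oppr_pchar2 char2).
rewrite -[LHS]mulr1 -dJ -det_mulmx mulmx_block.
by rewrite !(mulmx0, mulmx1, addr0, add0r) det_ublock det_tr expr2.
Qed.

Lemma schur_term_square n b (x : R) (U : 'M[R]_(n, b)) :
  constant_or_variable x -> schur_term (x *: (U *m U^T)).
Proof.
move=> hx; have [N [L [V [r [c [hL LV dL ->]]]]]] := realizable_all U.
(* [K] absorbs [c], so that in [D] the variable [x] is multiplied by the
   identity and not by [c *m c^T], which would give multiples of [x]. *)
pose K : 'M[R]_(N + b) := block_mx L (cmx (- c)) 0 1%:M.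
pose W : 'M[R]_(N + b) := block_mx V (V *m cmx c) 0 1%:M.
pose B : 'M[R]_(N + b) := block_mx 0 0 0 x%:M.
have sB : B^T = B by rewrite /B tr_block_mx !trmx0 tr_scalar_mx.
have KW : K *m W = 1%:M.
  rewrite mulmx_block !(mulmx0, mul0mx, mulmx1, mul1mx, addr0, add0r) LV.
  by rewrite mulmxA LV mul1mx map_mxN subrr -scalar_mx_block.
have WK := mulmx1C KW.
(* [C] meets only the last block of [E], whose sign cancels that of [schur_term]. The last block of
   [(r 0) W] is [U], and [B] keeps this block alone, with weight [x]. *)
exists (N + b + (N + b))%N, (block_mx B K K^T 0),
  (block_mx 0 W^T W (- (W *m B *m W^T))), (row_mx 0 (cmx (row_mx r 0))).
split; first split.
- by rewrite tr_block_mx sB trmxK trmx0.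
- have hK : cv_mx K.
    apply: cv_block_mx => //; [exact: cv_cmx | exact: cv_mx0 | exact: cv_mx1].
  apply: cv_block_mx => //; [|exact: cv_mxT|exact: cv_mx0].
  by apply: cv_block_mx; try exact: cv_mx0; apply: cv_scalar_mx.
- move=> i j; rewrite mxE; case: split => j'; [exact: cv_mx0 | exact: cv_cmx].
- rewrite mulmx_block !(mulmx0, mul0mx, addr0, add0r) -trmx_mul KW WK trmx1.
  rewrite mulNmx -[_ *m W^T *m K^T]mulmxA -trmx_mul KW trmx1 mulmx1 subrr.
  by rewrite -scalar_mx_block.
- by rewrite det_swap_block det_ublock dL det1 mulr1 expr1n.
- set Q := cmx r *m V *m cmx c; set r' := cmx (row_mx r 0).
  have Er : r' *m W = row_mx (cmx r *m V) Q.
    by rewrite /r' map_row_mx map_mx0 mul_row_block !(mul0mx, addr0) mulmxA.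
  rewrite tr_row_mx mul_row_block mul_row_col.
  rewrite !(mulmx0, mul0mx, trmx0, addr0, add0r) mulmxN mulNmx opprK.
  rewrite !mulmxA Er -mulmxA -trmx_mul Er /B mul_row_block tr_row_mx.
  rewrite !(mulmx0, mul0mx, addr0, add0r) mul_row_col mul0mx add0r.
  by rewrite mul_mx_scalar -scalemxAl.
Qed.

(** This handles the off-diagonal entries of a gSDR, which are arbitrary polynomials. *)
Lemma schur_term_addT n (T : 'M[R]_n) : schur_term (T + T^T).
Proof.
have sq (U : 'M[R]_n) : schur_term (U *m U^T).
  rewrite -[_ *m _]scale1r; apply: schur_term_square.
  exact: constant_or_variable1.
have opp (U : 'M[R]_n) : U + U = 0.
  by apply/matrixP=> i j; rewrite !mxE (addrr_pchar2 char2).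
have -> : T + T^T = (T + 1%:M) *m (T + 1%:M)^T + (T *m T^T + 1%:M *m 1%:M^T).
  rewrite linearD /= trmx1 mulmxDl !mulmxDr !mulmx1 mul1mx addrACA.
  by rewrite [_ + T + _]addrAC -[T^T + _ + _]addrA !opp add0r addr0.
by apply: schur_termD => //; apply: schur_termD.
Qed.

End Realizations.

(** * Passing between the two kinds of representation *)

Lemma has_gSDR_representable (F : fieldType) (hF : 2%N \in [pchar F]) (m : nat)
    (P : {mpoly F[m]}) :
  has_gSDR P -> representable P.
Proof.
have char2 : 2%N \in [pchar {mpoly F[m]}].
  by rewrite inE /= -mpolyC_nat (pcharf0 hF) mpolyC0 eqxx.
case=> n [M] [sM <- hM].
(* One format for both kinds of diagonal entry: a constant plus a twisted sum of squares, either
   part possibly zero. *)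
have hdiag i : exists d : F * {mpoly F[m]} * ('I_m -> {mpoly F[m]}),
    M i i = d.1.1%:MP + d.1.2 ^+ 2 + \sum_(k < m) 'X_k * d.2 k ^+ 2.
  case: (hM i) => [[c ->]|[P0 [Q ->]]].
    exists (c, 0, fun=> 0) => /=; rewrite expr0n addr0 big1 ?addr0 // => k _.
    by rewrite mulr0.
  by exists (0, P0, Q) => /=; rewrite mpolyC0 add0r.
have [d Hd] := fin_all_exists hdiag.
pose dg (f : 'I_n.+1 -> {mpoly F[m]}) := diag_mx (\row_i f i).
pose sq f := dg f *m (dg f)^T.
have dgsq f : sq f = dg (fun i => f i ^+ 2).
  rewrite /sq tr_diag_mx mulmx_diag; congr diag_mx.
  by apply/rowP=> i; rewrite !mxE expr2.
pose T : 'M[{mpoly F[m]}]_n.+1 := \matrix_(i, j) if (i < j)%N then M i j else 0.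
have -> : M = dg (fun i => (d i).1.1%:MP) + (sq (fun i => (d i).1.2) +
    \sum_(k < m) 'X_k *: sq (fun i => (d i).2 k) + (T + T^T)).
  apply/matrixP=> i j; rewrite !dgsq !mxE summxE.
  under eq_bigr => k _ do rewrite dgsq !mxE.
  have [<-|neq_ij] := eqVneq i j.
    rewrite ltnn !addr0 !mulr1n Hd -addrA; congr (_ + (_ + _)).
  rewrite !mulr0n big1 => [|k _]; last by rewrite mulr0.
  rewrite !add0r; case: ltngtP => [_|_|/val_inj eq_ij];
    rewrite ?addr0 ?add0r //.
    by rewrite -{1}sM mxE.
  by rewrite eq_ij eqxx in neq_ij.
(* The constants stay in the unbordered block: they need not be squares in [F]. *)
apply: det_add_schur_term; first by rewrite tr_diag_mx.
  move=> i j; rewrite !mxE; case: eqP => _.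
    by left; exists (d i).1.1.
  exact: constant_or_variable0.
apply: schur_termD; last exact: schur_term_addT.
apply: schur_termD.
  rewrite -[sq _]scale1r; apply: schur_term_square => //.
  exact: constant_or_variable1.
by apply: schur_term_sum => k; apply: schur_term_square => //; right; exists k.
Qed.

Theorem theorem3p5 (F : fieldType) (hF : 2%N \in [pchar F]) (m : nat)
  (P : {mpoly F[m]}) :
  representable P <-> has_gSDR P.
Proof.
split; last exact: has_gSDR_representable.
case=> n [M] [sM hM dM]; exists n, M; split=> // i.
case: (hM i i) => [|[k ->]]; [by left | right].
(* A variable is a twisted sum of squares with the single term ['X_k * 1 ^+ 2], so the same matrix
   is a gSDR. *)
exists 0, (fun j => (j == k)%:R); rewrite expr0n add0r (bigD1 k) //= eqxx.
rewrite expr1n mulr1 big1 ?addr0 // => j /negPf ->.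
by rewrite expr0n mulr0.
Qed.
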